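(* Let $(R,\mathfrak m)$ be a finite commutative local ring with identity $1\neq 0$, with $|R|=r$ and $|\mathfrak m|=m$. If $r$ is odd then $G_R^+$ has loops and its spectrum is strongly almost symmetric, given by $$Spec(G_R^+)=\{[r-m]^1,[m]^{\frac{r-m}{2m}},[0]^{\frac rm(m-1)},[-m]^{\frac{r-m}{2m}}\}$$ if $R$ is not a field ($m>1$) and by $$Spec(G_R^+)=\{[r-1]^1,[1]^{\frac{r-1}{2}},[-1]^{\frac{r-1}{2}}\}$$ if $R$ is a field ($m=1$). Moreover, $G_R$ and $G_R^+$ are integral equienergetic non-isospectral connected non-bipartite graphs.
   Context: For a finite commutative ring $R$ with unit group $R^*$: $G_R$ is the graph with vertex set $R$ in which $v,w$ are adjacent iff $w-v\in R^*$; $G_R^+$ is the graph with vertex set $R$ in which $v,w$ are adjacent iff $v+w\in R^*$ (with a loop at $x$ when $x+x\in R^*$). Both are undirected and $|R^*|$-regular (a loop contributes $1$ to the degree); a graph with a loop is not bipartite. Eigenvalues are those of the adjacency matrix (a loop gives a diagonal entry $1$); $Spec$ lists them with multiplicities as exponents. A graph is integral if all its eigenvalues are integers. The energy is the sum of the absolute values of the eigenvalues with multiplicity; two graphs with equally many vertices are equienergetic if their energies agree, and isospectral if their spectra agree. For a regular graph with principal eigenvalue $\lambda_0$ (its degree), the spectrum is strongly almost symmetric if $m(\lambda)=m(-\lambda)$ for all $\lambda\neq\pm\lambda_0$ and $|m(\lambda_0)-m(-\lambda_0)|=1$, where $m(\lambda)$ is the multiplicity of $\lambda$ ($0$ if $\lambda$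 is not an eigenvalue). *)

(* Defs.v *)
From HB Require Import structures.
From mathcomp Require Import all_boot all_order all_fingroup all_algebra all_field.

Set Implicit Arguments.
Unset Strict Implicit.
Unset Printing Implicit Defensive.

Import Order.TTheory GRing.Theory Num.Theory.
Local Open Scope ring_scope.

(** Finite undirected graphs, possibly with loops, are symmetric relations
    [e : rel T] on a finite type; a loop at [x] is [e x x]. *)

Section Graphs.

Variables (T : finType) (e : rel T).

Definition has_loop : Prop := exists x, e x x.

Definition connected_graph : Prop := forall x y, connect e x y.

Definition bipartite : Prop :=
  exists c : T -> bool, forall x y, e x y -> c x != c y.

(* A loop contributes 1 to the degree. *)
Definition regular_graph (k : nat) : Prop := forall x, #|[set y | e x y]| = k.

Definition adjacency : 'M[algC]_#|T| :=
  \matrix_(i, j) (e (enum_val i) (enum_val j))%:R.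

(* The roots in [algC] of the characteristic polynomial of [adjacency],
   repeated according to multiplicity, in an unspecified order; compare two
   spectra with [perm_eq]. *)
Definition spectrum : seq algC :=
  sval (closed_field_poly_normal (char_poly adjacency)).

Lemma char_poly_spectrum :
  char_poly adjacency = \prod_(z <- spectrum) ('X - z%:P).
Proof.
rewrite /spectrum; case: closed_field_poly_normal => s /= {1}->.
by rewrite (monicP (char_poly_monic _)) scale1r.
Qed.

Definition multiplicity (z : algC) : nat := count_mem z spectrum.

Definition integral_graph : Prop := {in spectrum, forall z, z \is a Num.int}.

Definition energy : algC := \sum_(z <- spectrum) `|z|.

(* The principal eigenvalue of a regular graph is its degree [k]. *)
Definition strongly_almost_symmetric : Prop :=
  exists2 k : nat, regular_graph k &
    (forall z : algC, z != k%:R -> z != - k%:R ->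
       multiplicity z = multiplicity (- z)) /\
    `|(multiplicity k%:R)%:Z - (multiplicity (- k%:R))%:Z| = 1.

End Graphs.

Definition equienergetic (T U : finType) (e : rel T) (f : rel U) : Prop :=
  #|T| = #|U| /\ energy e = energy f.

Definition isospectral (T U : finType) (e : rel T) (f : rel U) : Prop :=
  perm_eq (spectrum e) (spectrum f).

Section RingGraphs.

Variable R : finComUnitRingType.

(* [idealr_closed] is the library's predicate for proper ideals. *)
Definition maximal_ideal (M : {set R}) : Prop :=
  idealr_closed M /\
  forall I : {set R}, idealr_closed I -> M \subset I -> I = M.

(* [(R, M)] is a local ring: [M] is the unique maximal ideal of [R]. *)
Definition local_ring (M : {set R}) : Prop :=
  maximal_ideal M /\ forall N : {set R}, maximal_ideal N -> N = M.

Definition unitary_cayley : rel R := fun v w => w - v \is a GRing.unit.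

Definition unitary_cayley_sum : rel R := fun v w => v + w \is a GRing.unit.

Lemma unitary_cayley_sym : symmetric unitary_cayley.
Proof. by move=> v w; rewrite /unitary_cayley -unitrN opprB. Qed.

Lemma unitary_cayley_sum_sym : symmetric unitary_cayley_sum.
Proof. by move=> v w; rewrite /unitary_cayley_sum addrC. Qed.

End RingGraphs.

Arguments unitary_cayley : clear implicits.
Arguments unitary_cayley_sum : clear implicits.

(* Main.v *)
Require Import Defs.
From HB Require Import structures.
From mathcomp Require Import all_boot all_order all_fingroup all_algebra all_solvable all_field.
From mathcomp Require Import ring zify.

Set Implicit Arguments.
Unset Strict Implicit.
Unset Printing Implicit Defensive.

Import Order.TTheory GRing.Theory Num.Theory.
Local Open Scope ring_scope.

(** Write [M] for the maximal ideal, so that the units of the ring are the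
    elements outside [M].  The graph [G_R] joins [v] to [w] when [w - a * v] is
    a unit with [a = 1], and [G_R^+] is the same graph with [a = -1].  Both are
    treated at once for an arbitrary [a] with [a * a = 1]: the adjacency matrix
    is [J - B_a], where [J] is the all-ones matrix and [B_a] is the indicator of
    [w - a * v \in M] ([adjacency_coset_mx]).

    Membership in [M] depends on cosets only, which makes these matrices multiply
    like their parameters, [B_a B_b = m B_{ba}] ([coset_mx_mul]), while [B_a]
    acts on [J] as the scalar [m].  Hence [p = B_1 / m] and [j = J / r] are
    commuting projections with [p j = j], and [b = B_a / m] satisfies [b^2 = p].
    It follows that [j], [(p - b) / 2], [1 - p] and [(p + b) / 2 - j] are mutually
    orthogonal projections of sum [1], on which the adjacency matrix
    [r j - m b] acts as [r - m], [m], [0] and [- m].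

    A matrix [\sum_i z_i E_i] with such [E_i] has characteristic polynomial
    [\prod_i (X - z_i)^(rank E_i)] ([char_poly_spectral_resolution]): subtracted
    from [X], it is the product of the [1 + (X - z_i - 1) E_i], whose
    determinants are powers of [X - z_i] by the identity
    [det (1 + A B) = det (1 + B A)].  The rank of a projection is its trace, and
    the traces only involve [r], [m] and the number [t] of [x] such that
    [x - a * x \in M] ([spectrum_coset_graph]).  As ranks are natural numbers,
    the divisibility of [r] by [m], and of [r - m] by [2 m], comes for free.

    For [a = 1] one has [t = r], so [m] is not an eigenvalue.  For [a = -1], [2]
    is a unit because [r] is odd, so [t = m] and [m], [- m] are eigenvalues of
    the same multiplicity [(r - m) / (2 m) > 0].  The graphs are thus not
    isospectral, but the total multiplicity of [m] and [- m] does not depend on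
    [t], so the energies agree. *)

(** * Determinants of sums of projections *)

(** Sylvester's identity: both sides are the determinant of the block matrix
    [L], cleared by column operations on one side or on the other. *)
Lemma det_add1_mulmxC (S : comNzRingType) (n k : nat)
    (A : 'M[S]_(n, k)) (B : 'M[S]_(k, n)) :
  \det (1%:M + A *m B) = \det (1%:M + B *m A).
Proof.
pose L := block_mx 1%:M (- A) B 1%:M.
have <-: \det (L *m block_mx 1%:M 0 (- B) 1%:M) = \det (1%:M + A *m B).
  rewrite mulmx_block !mulmx1 !mul1mx !mulmx0 add0r mulNmx mulmxN opprK addrN.
  by rewrite add0r det_ublock det1 mulr1.
have <-: \det (L *m block_mx 1%:M A 0 1%:M) = \det (1%:M + B *m A).
  rewrite mulmx_block !mulmx1 !mul1mx !mulmx0 !addr0 addrN.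
  by rewrite det_lblock det1 mul1r addrC.
by rewrite !det_mulmx det_lblock det_ublock !det1.
Qed.

Section Projections.

Variables (F : fieldType) (n : nat).
Implicit Types E A : 'M[F]_n.

(** [col_base E *m row_base E] is the rank factorization of [E]; in the equation
    [E *m E = E] its outer factors can be cancelled. *)
Lemma row_base_col_base E : E *m E = E -> row_base E *m col_base E = 1%:M.
Proof.
move=> EE; apply: (row_free_inj (row_base_free E)).
apply: (row_full_inj (col_base_full E)).
by rewrite mul1mx -mulmxA !mulmx_base mulmxA mulmx_base EE.
Qed.

Lemma mxtrace_idempotent E : E *m E = E -> \tr E = (\rank E)%:R.
Proof.
by move=> EE; rewrite -{1}(mulmx_base E) mxtrace_mulC row_base_col_base ?mxtrace1.
Qed.

Lemma det_add1_idempotent E (c : {poly F}) :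
  E *m E = E -> \det (1%:M + c *: map_mx polyC E) = (1 + c) ^+ \rank E.
Proof.
move=> EE; rewrite -{1}(mulmx_base E) map_mxM scalemxAl det_add1_mulmxC.
rewrite -scalemxAr -map_mxM row_base_col_base // map_mx1 scalemx1.
by rewrite -raddfD det_scalar.
Qed.

(** Orthogonality turns the sum into the product of the [1 + c E]; only the
    products in the order of the list need to vanish. *)
Lemma det_add1_sum_idempotents (c : F -> {poly F}) (s : seq (F * 'M[F]_n)) :
    all (fun x => x.2 *m x.2 == x.2) s ->
    pairwise (fun x y => x.2 *m y.2 == 0) s ->
  \det (1%:M + \sum_(x <- s) c x.1 *: map_mx polyC x.2)
    = \prod_(x <- s) (1 + c x.1) ^+ \rank x.2.
Proof.
elim: s => [|x s IHs] /=; first by rewrite !big_nil addr0 det1.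
case/andP=> /eqP xx ss /andP[/allP xs Ps]; rewrite !big_cons -IHs //.
rewrite -(det_add1_idempotent _ xx) -det_mulmx; congr (\det _).
rewrite mulmxDr mulmx1 mulmxDl mul1mx mulmx_sumr [X in _ + (_ + X)]big1_seq.
  by rewrite addr0 addrA.
move=> y /andP[_ /xs/eqP xy].
by rewrite -scalemxAl -scalemxAr -map_mxM xy map_mx0 !scaler0.
Qed.

(** The eigenvalues [x.1] need not be distinct, and the projections may vanish:
    this lets one list cover several spectra. *)
Lemma char_poly_spectral_resolution A (s : seq (F * 'M[F]_n)) :
    all (fun x => x.2 *m x.2 == x.2) s ->
    pairwise (fun x y => x.2 *m y.2 == 0) s ->
    \sum_(x <- s) x.2 = 1%:M ->
    \sum_(x <- s) x.1 *: x.2 = A ->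
  char_poly A = \prod_(x <- s) ('X - x.1%:P) ^+ \rank x.2.
Proof.
move=> ss Ps s1 <-; pose c z : {poly F} := 'X - z%:P - 1.
transitivity (\prod_(x <- s) (1 + c x.1) ^+ \rank x.2); last first.
  by apply: eq_bigr => x _; rewrite /c addrC subrK.
rewrite -det_add1_sum_idempotents //; congr (\det _).
have map1: \sum_(x <- s) map_mx polyC x.2 = 1%:M
  by rewrite -(map_mx1 polyC) -s1 raddf_sum.
rewrite /char_poly_mx -(scalemx1 _ 'X) -map1 (raddf_sum (map_mx polyC)) scaler_sumr.
rewrite -sumrB -big_split /=; apply: eq_bigr => x _.
rewrite map_mxZ -scalerBl -[X in _ = X + _]scale1r -scalerDl.
by rewrite /c [1 + _]addrC subrK.
Qed.

End Projections.

(** * Sums over tallies and enumerations *)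

Lemma big_tally_seq (R : Type) (idx : R) (op : Monoid.law idx) (T : eqType)
    (bs : seq (T * nat)) (f : T -> R) :
  \big[op/idx]_(z <- tally_seq bs) f z
    = \big[op/idx]_(b <- bs) iter b.2 (op (f b.1)) idx.
Proof.
rewrite big_flatten big_map; apply: eq_bigr => b _.
by rewrite big_nseq.
Qed.

Lemma count_mem_tally_seq (T : eqType) (z : T) (bs : seq (T * nat)) :
  count_mem z (tally_seq bs) = (\sum_(b <- bs) (b.1 == z) * b.2)%N.
Proof.
rewrite count_flatten -map_comp sumnE big_map; apply: eq_bigr => b _.
by rewrite /= count_nseq.
Qed.

Lemma sum_enum_val_indicator (T : finType) (P : pred T) :
  \sum_(i < #|T|) (P (enum_val i))%:R = #|[set x | P x]|%:R :> algC.
Proof.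
rewrite -(@big_enum_val _ _ _ _ T (fun x => (P x)%:R)) -natr_sum -sum1dep_card.
by rewrite [in RHS]big_mkcond; congr _%:R; apply: eq_bigr => x _; case: (P x).
Qed.

(** * The algebra generated by an involution and a projection of rank one *)

(** On the image of the projection [p], [b] is an involution fixing the line
    [j]; [dp] and [dn] count its eigenvalues [-1] and, off that line, [1], and
    [d0] is the corank of [p]. *)
Lemma char_poly_involution (F : numFieldType) n (p b j : 'M[F]_n) (k mu : F) :
    p *m p = p -> b *m b = p -> p *m b = b -> b *m p = b ->
    j *m j = j -> p *m j = j -> j *m p = j -> b *m j = j -> j *m b = j ->
    \tr j = 1 ->
  exists dp d0 dn : nat,
    [/\ \tr p = \tr b + dp%:R * 2,
        d0%:R = n%:R - \tr p,
        \tr p + \tr b = (dn%:R + 1) * 2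
      & char_poly (k *: j - mu *: b) = \prod_(z <- tally_seq
          [:: (k - mu, 1%N); (mu, dp); (0, d0); (- mu, dn)]) ('X - z%:P)].
Proof.
move=> pp bb pb bp jj pj jp bj jb trj.
(* [k *: j - mu *: b] acts on the image of each projection as its first component. *)
pose s := [:: (k - mu, j); (mu, 2^-1 *: (p - b)); (0, 1%:M - p);
  (- mu, 2^-1 *: (p + b) - j)].
have expand := (mulmxDl, mulmxDr, mulNmx, mulmxN, mul1mx, mulmx1).
have table := (pp, bb, pb, bp, jj, pj, jp, bj, jb).
have ss : all (fun x => x.2 *m x.2 == x.2) s.
  apply/and5P; split=> //=; apply/eqP;
    rewrite ?expand -?(scalemxAl, scalemxAr) ?expand ?table;
    apply/matrixP=> u v; rewrite ?mxE; by field.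
have Ps : pairwise (fun x y => x.2 *m y.2 == 0) s.
  rewrite /= !andbT -!andbA; apply/and5P; split; last (apply/andP; split);
    apply/eqP; rewrite ?expand -?(scalemxAl, scalemxAr) ?expand ?table;
    apply/matrixP=> u v; rewrite ?mxE; by field.
have s1 : \sum_(x <- s) x.2 = 1%:M.
  by rewrite !big_cons big_nil /=; apply/matrixP=> u v; rewrite ?mxE; by field.
have sA : \sum_(x <- s) x.1 *: x.2 = k *: j - mu *: b.
  by rewrite !big_cons big_nil /=; apply/matrixP=> u v; rewrite ?mxE; by field.
have /and5P[/eqP _ /eqP/mxtrace_idempotent tp /eqP/mxtrace_idempotent t0
  /eqP/mxtrace_idempotent tn _] := ss.
exists (\rank (2^-1 *: (p - b))), (\rank (1%:M - p)), (\rank (2^-1 *: (p + b) - j)).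
have rj : \rank j = 1%N.
  by apply/eqP; rewrite -(eqr_nat F) -mxtrace_idempotent // trj.
split.
- by rewrite -tp mxtraceZ raddfB /=; field.
- by rewrite -t0 raddfB /= mxtrace1.
- by rewrite -tn raddfB /= mxtraceZ raddfD /= trj; field.
rewrite (char_poly_spectral_resolution ss Ps s1 sA) big_tally_seq.
by rewrite !big_cons !big_nil !iter_mulr_1 /= rj.
Qed.

(** * Finite local rings *)

Section LocalRing.

Variables (R : finComUnitRingType) (M : {set R}).

Lemma idealr_closed_nonunit (I : {set R}) x :
  idealr_closed I -> x \in I -> x \isn't a GRing.unit.
Proof.
case=> I0 I1 IP xI; apply: contra I1 => ux.
by rewrite -(mulVr ux) -[_ * x]addr0 IP.
Qed.

(** Finiteness provides a maximal element; [P] is the boolean form of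
    [idealr_closed] that selecting a maximal set requires. *)
Lemma maximal_ideal_exists (I : {set R}) :
  idealr_closed I -> exists2 N : {set R}, maximal_ideal N & I \subset N.
Proof.
pose P (A : {set R}) := [&& 0 \in A, 1 \notin A
  & [forall a, [forall u in A, [forall v in A, a * u + v \in A]]]].
have PP (A : {set R}) : reflect (idealr_closed A) (P A).
  apply: (iffP and3P) => -[A0 A1 AP]; split=> //.
    by move=> a u v uA vA; move/forallP/(_ a)/forall_inP/(_ u uA)/forall_inP: AP; apply.
  by apply/forallP=> a; apply/forall_inP=> u uA; apply/forall_inP=> v; apply: AP.
move/PP/maxset_exists => [N /maxsetP[/PP NP Nmax] IN]; exists N => //.
by split=> // A /PP AP NA; apply: Nmax.
Qed.

Lemma principal_ideal_closed (x : R) :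
  x \isn't a GRing.unit -> idealr_closed [set y * x | y in R].
Proof.
move=> Ux; split.
- by apply/imsetP; exists 0; rewrite ?mul0r.
- apply/negP=> /imsetP[y _ yx]; case/unitrP: Ux; exists y.
  by rewrite [x * y]mulrC -yx.
- move=> a _ _ /imsetP[y _ ->] /imsetP[z _ ->]; apply/imsetP.
  by exists (a * y + z); rewrite // mulrDl mulrA.
Qed.

(** A nonunit generates a proper ideal, which lies in some maximal ideal, hence in
    the only one. *)
Lemma local_ring_unitE : local_ring M -> forall x, (x \is a GRing.unit) = (x \notin M).
Proof.
case=> -[MP _] Muniq x; apply/idP/idP.
  by apply: contraL => /(idealr_closed_nonunit MP).
apply: contraR => Ux; have [N Nmax xN] := maximal_ideal_exists (principal_ideal_closed Ux).
rewrite -(Muniq N Nmax) (subsetP xN) //; apply/imsetP; exists 1 => //.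
by rewrite mul1r.
Qed.

Hypothesis MP : idealr_closed M.
Hypothesis unitE : forall x : R, (x \is a GRing.unit) = (x \notin M).

Let M0 : 0 \in M. Proof. by case: MP. Qed.
Let M1 : 1 \notin M. Proof. by case: MP. Qed.
Let memD x y : x \in M -> y \in M -> x + y \in M.
Proof. by case: MP => _ _ h xM yM; rewrite -[x]mul1r h. Qed.
Let memM a x : x \in M -> a * x \in M.
Proof. by case: MP => _ _ h xM; rewrite -[_ * _]addr0 h. Qed.
Let memN x : x \in M -> - x \in M.
Proof. by rewrite -mulN1r; apply: memM. Qed.
Let memDl x y : x \in M -> (x + y \in M) = (y \in M).
Proof.
move=> xM; apply/idP/idP; last exact: memD.
by move=> /(memD (memN xM)); rewrite addKr.
Qed.

Let unitD u x : u \is a GRing.unit -> x \in M -> u + x \is a GRing.unit.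
Proof. by rewrite !unitE => uM xM; rewrite addrC memDl. Qed.

(** The additive order of [1] divides the odd number [#|R|], so [2 \in M] would
    give [1 \in M]. *)
Lemma odd_card_unit2 : odd #|R| -> (2 : R) \is a GRing.unit.
Proof.
move=> oddR; rewrite unitE; apply: contra M1 => M2.
have r0 : (#|R|%:R : R) = 0.
  by rewrite -FinRing.zmodXgE -cardsT; apply: expg_cardG; rewrite inE.
have -> : (1 : R) = - (#|R|./2%:R * 2) + #|R|%:R.
  by rewrite -{2}(odd_double_half #|R|) oddR natrD -muln2 natrM addrC addrK.
by rewrite r0 addr0 memN // memM.
Qed.

Let card_translate (x : R) : #|[set y | y - x \in M]| = #|M|.
Proof.
by rewrite -(card_preimset M (subIr x)); apply: eq_card => y; rewrite !inE.
Qed.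

(** * The adjacency matrices *)

(** The indicator matrix of the relation [w \in a * v + M]. *)
Definition coset_mx (a : R) : 'M[algC]_#|R| :=
  \matrix_(i, j) (enum_val j - a * enum_val i \in M)%:R.

(** For [y \in a * x + M], [z \in b * y + M] holds iff [z \in b * a * x + M]:
    either all [#|M|] such [y] count, or none. *)
Lemma coset_mx_mul a b : coset_mx a *m coset_mx b = #|M|%:R *: coset_mx (b * a).
Proof.
apply/matrixP=> i k; rewrite !mxE; set x := enum_val i; set z := enum_val k.
under eq_bigr do rewrite !mxE -/x -/z -natrM mulnb.
rewrite (sum_enum_val_indicator (fun y => (y - a * x \in M) && (z - b * y \in M))).
have zE (y : R) : z - b * a * x = b * (y - a * x) + (z - b * y) by ring.
have [zM | zNM] := boolP (z - b * a * x \in M).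
  rewrite mulr1 -(card_translate (a * x)); congr _%:R; apply: eq_card => y.
  rewrite !inE; case: (boolP (_ \in M)) => //= yM.
  by rewrite -(memDl _ (memM b yM)) -zE.
rewrite mulr0 (_ : [set _ | _] = set0) ?cards0 //; apply/setP=> y; rewrite !inE.
apply: contraNF zNM => /andP[yM zM].
by rewrite (zE y) memD ?memM.
Qed.

Lemma coset_mx_mul_ones a : coset_mx a *m const_mx 1 = #|M|%:R *: const_mx 1 :> 'M_#|R|.
Proof.
apply/matrixP=> i k; rewrite !mxE mulr1.
under eq_bigr do rewrite !mxE mulr1.
by rewrite (sum_enum_val_indicator (fun y => y - a * enum_val i \in M)) card_translate.
Qed.

Lemma ones_mul_coset_mx a :
  a * a = 1 -> const_mx 1 *m coset_mx a = #|M|%:R *: const_mx 1 :> 'M_#|R|.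
Proof.
move=> aa; apply/matrixP=> i k; rewrite !mxE mulr1.
under eq_bigr do rewrite !mxE mul1r.
rewrite (sum_enum_val_indicator (fun y => enum_val k - a * y \in M)).
rewrite -(card_translate (a * enum_val k)); congr _%:R; apply: eq_card => y.
rewrite !inE; have -> : y - a * enum_val k = - a * (enum_val k - a * y).
  by rewrite mulrBr !mulNr opprK mulrA aa mul1r addrC.
apply/idP/idP ; first exact: memM.
by move=> /(memM (- a)); rewrite mulrA mulrNN aa mul1r.
Qed.

Lemma mxtrace_coset_mx a : \tr (coset_mx a) = #|[set x | x - a * x \in M]|%:R.
Proof.
rewrite /mxtrace; under eq_bigr do rewrite mxE.
exact: (sum_enum_val_indicator (fun x => x - a * x \in M)).
Qed.

(** * Spectrum and energy *)

Section Graph.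

Variables (a : R) (e : rel R).
Hypothesis aa : a * a = 1.
Hypothesis eE : forall v w, e v w = (w - a * v \is a GRing.unit).

Lemma adjacency_coset_mx : adjacency e = const_mx 1 - coset_mx a.
Proof.
apply/matrixP=> i j; rewrite !mxE eE unitE.
by case: (_ \in M); rewrite ?subrr ?subr0.
Qed.

Lemma regular_coset_graph : regular_graph e (#|R| - #|M|).
Proof.
move=> v; rewrite -(card_translate (a * v)) cardsCs; congr (_ - #|pred_of_set _|)%N.
by apply/setP=> y; rewrite !inE eE unitE negbK.
Qed.

(** [t] is the trace of [coset_mx a]: [#|R|] for [a = 1] and, when [2] is a unit,
    [#|M|] for [a = -1]. *)
Let t := #|[set x | x - a * x \in M]|.

(** The equations say [dp = (r - t) / (2 m)], [d0 = r - r / m] and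
    [dn = (r + t) / (2 m) - 1] for [r = #|R|] and [m = #|M|]; as equations in
    [nat] they also assert that these divisions are exact. *)
Lemma spectrum_coset_graph : exists dp d0 dn : nat,
  [/\ (#|R| = t + 2 * (#|M| * dp))%N,
      (#|M| * d0 + #|R| = #|M| * #|R|)%N,
      (#|R| + t = 2 * (#|M| * dn.+1))%N
    & perm_eq (spectrum e) (tally_seq
        [:: (#|R|%:R - #|M|%:R, 1%N); (#|M|%:R, dp); (0, d0); (- #|M|%:R, dn)])].
Proof.
set r := #|R|; set m := #|M|.
have m_n0 : m%:R != 0 :> algC by rewrite pnatr_eq0 -lt0n; apply/card_gt0P; exists 0.
have r_n0 : r%:R != 0 :> algC by rewrite pnatr_eq0 -lt0n; apply/card_gt0P; exists 0.
pose p := m%:R^-1 *: coset_mx 1; pose b := m%:R^-1 *: coset_mx a.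
pose j := r%:R^-1 *: const_mx 1 : 'M[algC]_r.
have scaleK (C : 'M[algC]_r) : m%:R^-1 *: (m%:R *: C) = C.
  by rewrite scalerA mulVf // scale1r.
have pbE c d : (m%:R^-1 *: coset_mx c) *m (m%:R^-1 *: coset_mx d) = m%:R^-1 *: coset_mx (d * c).
  by rewrite -scalemxAl -scalemxAr coset_mx_mul scaleK.
have cj c : (m%:R^-1 *: coset_mx c) *m j = j.
  by rewrite -scalemxAl -scalemxAr coset_mx_mul_ones [r%:R^-1 *: _]scalerA mulrC -scalerA scaleK.
have jc c : c * c = 1 -> j *m (m%:R^-1 *: coset_mx c) = j.
  by move=> cc; rewrite -scalemxAl -scalemxAr ones_mul_coset_mx // scaleK.
have jj : j *m j = j.
  rewrite -scalemxAl -scalemxAr; apply/matrixP=> i k; rewrite !mxE.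
  under eq_bigr do rewrite !mxE mulr1.
  by rewrite sumr_const card_ord; field.
have trj : \tr j = 1.
  rewrite mxtraceZ /mxtrace; under eq_bigr do rewrite mxE.
  by rewrite sumr_const card_ord; field.
have pp : p *m p = p by rewrite pbE mulr1.
have bb : b *m b = p by rewrite pbE aa.
have pb : p *m b = b by rewrite pbE mulr1.
have bp : b *m p = b by rewrite pbE mul1r.
have [dp [d0 [dn [E1 E2 E3 E4]]]] := char_poly_involution r%:R m%:R pp bb pb bp
  jj (cj 1) (jc 1 (mulr1 1)) (cj a) (jc a aa) trj.
have trp : \tr p = m%:R^-1 * r%:R.
  rewrite mxtraceZ mxtrace_coset_mx (_ : [set _ | _] = setT) ?cardsT //.
  by apply/setP=> x; rewrite !inE mul1r subrr M0.
have trb : \tr b = m%:R^-1 * t%:R by rewrite mxtraceZ mxtrace_coset_mx.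
exists dp, d0, dn; split.
- apply/eqP; rewrite -(eqr_nat algC) natrD !natrM; apply/eqP.
  move/(congr1 ( *%R m%:R)): E1; rewrite trp trb mulrDr !mulVKf // => ->; ring.
- apply/eqP; rewrite -(eqr_nat algC) natrD !natrM E2 trp; apply/eqP; by field.
- apply/eqP; rewrite -(eqr_nat algC) natrD !natrM -natr1; apply/eqP.
  move/(congr1 ( *%R m%:R)): E3; rewrite trp trb mulrDr !mulVKf // => ->; ring.
apply: prod_XsubC_eq; rewrite -char_poly_spectrum -E4 adjacency_coset_mx.
have -> : r%:R *: j = const_mx 1 by rewrite scalerA divff // scale1r.
by have -> : m%:R *: b = coset_mx a by rewrite scalerA divff // scale1r.
Qed.

(** The trace equations give [m * (dp + dn) = r - m], whatever [t] is. *)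
Lemma energy_coset_graph : energy e = (2 * (#|R| - #|M|))%:R.
Proof.
have [dp [d0 [dn [E1 E2 E3 E]]]] := spectrum_coset_graph.
have leMR : (#|M| <= #|R|)%N by apply: max_card.
rewrite /energy (perm_big _ E) big_tally_seq !big_cons big_nil.
rewrite !iter_addr_0 /= normr0 mul0rn normrN -natrB // !normr_nat -!mulrnA addr0 add0r -!natrD.
congr _%:R; move: E1 E3 leMR; rewrite mulnS.
by move: #|M| #|R| t => m r s; lia.
Qed.

Lemma integral_coset_graph : integral_graph e.
Proof.
have [dp [d0 [dn [_ _ _ /perm_mem E]]]] := spectrum_coset_graph.
move=> z; rewrite E => /flattenP[_ /mapP[x xs ->]]; rewrite mem_nseq => /andP[_ /eqP->].
move: xs; rewrite !inE => /or4P[]/eqP-> /=; by rewrite ?rpredN ?rpredB ?rpred_nat ?rpred0.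
Qed.

End Graph.

(** * Connectedness and odd closed walks *)

(** If [y - x \in M], then [x + 1] is a common neighbour of [x] and [y]. *)
Lemma unitary_cayley_connected : connected_graph (unitary_cayley R).
Proof.
move=> x y; have [|] := boolP (unitary_cayley R x y); first exact: connect1.
rewrite /unitary_cayley unitE negbK => yxM.
apply: (@connect_trans _ _ (x + 1)); apply: connect1; rewrite /unitary_cayley.
  by rewrite addrC addKr unitr1.
by rewrite opprD addrA addrC unitD ?unitrN1.
Qed.

(** If [x + y \in M], then [x] and [y] are both units or both in [M]; their
    common neighbour is [0] in the former case and [1] in the latter. *)
Lemma unitary_cayley_sum_connected : connected_graph (unitary_cayley_sum R).
Proof.
move=> x y; have [|] := boolP (unitary_cayley_sum R x y); first exact: connect1.
rewrite /unitary_cayley_sum unitE negbK => xyM.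
have [Ux | ] := boolP (x \is a GRing.unit).
  apply: (@connect_trans _ _ 0); apply: connect1; rewrite /unitary_cayley_sum.
    by rewrite addr0.
  by rewrite add0r -(addKr x y) unitD ?unitrN.
rewrite unitE negbK => xM.
apply: (@connect_trans _ _ 1); apply: connect1; rewrite /unitary_cayley_sum.
  by rewrite addrC unitD ?unitr1.
by rewrite -(addKr x y) unitD ?unitr1 // memD ?memN.
Qed.

End LocalRing.

(** [0], [1], [-1] is a triangle. *)
Lemma unitary_cayley_not_bipartite (R : finComUnitRingType) :
  (2 : R) \is a GRing.unit -> ~ bipartite (unitary_cayley R).
Proof.
move=> unit2 [c ce].
have c01 : c 0 != c 1 by apply: ce; rewrite /unitary_cayley subr0 unitr1.
have c12 : c 1 != c (-1) by apply: ce; rewrite /unitary_cayley -opprD unitrN.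
have c20 : c (-1) != c 0 by apply: ce; rewrite /unitary_cayley sub0r opprK unitr1.
by move: c01 c12 c20; case: (c 0); case: (c 1); case: (c (-1)).
Qed.

Lemma has_loop_not_bipartite (T : finType) (e : rel T) : has_loop e -> ~ bipartite e.
Proof. by case=> x exx [c /(_ x x exx)]; rewrite eqxx. Qed.

(** * The unitary Cayley graphs *)

Theorem proposition3p2 (R : finComUnitRingType) (M : {set R}) (r m : nat)
    (hloc : local_ring M) (hr : #|R| = r) (hm : #|M| = m) (hodd : odd r) :
  let G := unitary_cayley R in
  let Gp := unitary_cayley_sum R in
  [/\ has_loop Gp,
      strongly_almost_symmetric Gp,
      (GRing.field_axiom R <-> m = 1%N) /\
      (~ GRing.field_axiom R <-> (1 < m)%N),
      (~ GRing.field_axiom R ->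
         perm_eq (spectrum Gp)
           (tally_seq [:: (r%:R - m%:R, 1%N);
                          (m%:R, ((r - m) %/ (2 * m))%N);
                          (0, (r %/ m * (m - 1))%N);
                          (- m%:R, ((r - m) %/ (2 * m))%N)])) /\
      (GRing.field_axiom R ->
         perm_eq (spectrum Gp)
           (tally_seq [:: (r%:R - 1, 1%N);
                          (1, ((r - 1) %/ 2)%N);
                          (- 1, ((r - 1) %/ 2)%N)])) &
      [/\ integral_graph G /\ integral_graph Gp,
          equienergetic G Gp,
          ~ isospectral G Gp,
          connected_graph G /\ connected_graph Gp &
          ~ bipartite G /\ ~ bipartite Gp]].
Proof.
move=> G Gp; have unitE := local_ring_unitE hloc; have [[MP _] _] := hloc.
have [M0 M1 _] := MP.
have unit2 : (2 : R) \is a GRing.unit by apply: (odd_card_unit2 MP unitE); rewrite hr.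
have GE v w : G v w = (w - 1 * v \is a GRing.unit) by rewrite mul1r.
have GpE v w : Gp v w = (w - -1 * v \is a GRing.unit) by rewrite mulN1r opprK addrC.
have aa : -1 * -1 = 1 :> R by rewrite mulrNN mulr1.
have m_gt0 : (0 < m)%N by rewrite -hm; apply/card_gt0P; exists 0.
have ltmr : (m < r)%N.
  rewrite -hm -hr -cardsT; apply/proper_card/properP; split; first exact: subsetT.
  by exists 1; rewrite ?inE.
have fieldE : GRing.field_axiom R <-> m = 1%N.
  split=> [Rfield | m1].
    rewrite -hm (_ : M = [set 0]) ?cards1 //; apply/setP=> x; rewrite inE.
    apply/idP/eqP => [|-> //]; apply: contraTeq => /Rfield; by rewrite unitE.
  move=> x x0; rewrite unitE; apply: contra x0 => xM.
  by rewrite -hm in m1; move/eqP/cards1P: m1 xM M0 => [y ->]; rewrite !inE => /eqP-> /eqP->.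
have tG : #|[set x | x - 1 * x \in M]| = r.
  rewrite -hr -cardsT; apply: eq_card => x; by rewrite !inE mul1r subrr.
have tGp : #|[set x | x - -1 * x \in M]| = m.
  have mem2 (x : R) : (x - -1 * x \in M) = (x \in M).
    apply: negb_inj; rewrite -!unitE mulN1r opprK -mulr2n -mulr_natl.
    by rewrite unitrMr.
  by rewrite -hm; apply: eq_card => x; rewrite inE mem2.
have [d [d0 [d' [rE d0E d'E specGp]]]] := spectrum_coset_graph MP unitE aa GpE.
rewrite tGp hr hm in rE d0E d'E specGp.
(* Since [t = m], both [2 * m * d] and [2 * m * d'] equal [r - m]. *)
have dd' : d' = d by nia.
have {d'E} d_gt0 : (0 < d)%N by nia.
have d0q : d0 = (d.*2.+1 * (m - 1))%N by nia.
have divq : (r %/ m)%N = d.*2.+1.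
  by rewrite (_ : r = d.*2.+1 * m)%N ?mulnK //; nia.
have divd : ((r - m) %/ (2 * m))%N = d.
  by rewrite rE addKn mulnA mulKn // muln_gt0.
rewrite dd' d0q in specGp => {d' dd' d0 d0q d0E}.
have specG := spectrum_coset_graph MP unitE (mulr1 1) GE.
pose k : algC := (r - m)%:R.
(* [r = 2 * m] is excluded by parity: the degree is not the eigenvalue [m]. *)
have mk : (m%:R == k) = false by rewrite eqr_nat; apply/eqP; nia.
have mNk : (m%:R == - k) = false by rewrite -addr_eq0 -natrD pnatr_eq0 addn_eq0 gtn_eqF.
have k0 : (k == 0) = false by rewrite pnatr_eq0 subn_eq0 leqNgt ltmr.
have multE z : multiplicity Gp z = ((k == z)%R + (m%:R == z)%R * d
    + (0 == z)%R * (d.*2.+1 * (m - 1)) + (- m%:R == z)%R * d)%N.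
  rewrite /multiplicity (seq.permP specGp) count_mem_tally_seq !big_cons big_nil /=.
  by rewrite muln1 addn0 !addnA -natrB // ltnW.
have loopGp : has_loop Gp by exists 1; rewrite /Gp /unitary_cayley_sum -[1 + 1]/(2).
split=> //.
- exists (r - m)%N; first by rewrite -hr -hm; apply: regular_coset_graph GpE.
  split=> [z zk zNk|].
    rewrite !multE -!eqr_oppLR opprK oppr0 !(eq_sym _ z) (negbTE zk) (negbTE zNk).
    by rewrite !add0n addnAC [RHS]addnAC; congr (_ + _)%N; exact: addnC.
  rewrite !multE eqxx eqr_opp mk mNk !(eq_sym 0) oppr_eq0 k0.
  rewrite -[- m%:R == _]eqr_opp opprK mNk -addr_eq0 -natrD pnatr_eq0 addnn double_eq0 subn_eq0.
  by rewrite leqNgt ltmr.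
- by split=> //; rewrite fieldE ltn_neqAle m_gt0 andbT eq_sym; split=> /eqP.
- split=> [_ | /fieldE m1]; first by rewrite divd divq.
  by move: specGp; rewrite -divd m1 muln0 muln1.
split.
- split=> z.
    exact: (integral_coset_graph MP unitE (mulr1 1) GE).
  exact: (integral_coset_graph MP unitE aa GpE).
- split=> //.
  by rewrite (energy_coset_graph MP unitE (mulr1 1) GE) (energy_coset_graph MP unitE aa GpE).
(* [m] is an eigenvalue of [Gp] since [d > 0], but not of [G], where [t = r]. *)
- move=> /seq.permP/(_ (pred1 m%:R)); rewrite -[RHS]/(multiplicity Gp _) multE eqxx.
  case: specG => dp [d0 [dn [rE' _ _ /seq.permP->]]].
  rewrite tG hr hm in rE' *; have -> : dp = 0%N.
    apply/eqP; move/eqP: rE'; rewrite -{1}[r]addn0 eqn_add2l eq_sym !muln_eq0.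
    by rewrite (gtn_eqF m_gt0).
  rewrite count_mem_tally_seq !big_cons big_nil /= -natrB ?(ltnW ltmr) // -/k.
  rewrite (eq_sym k) mk (eq_sym 0) pnatr_eq0 (eq_sym (- _)) -addr_eq0 -natrD pnatr_eq0.
  rewrite addn_eq0 (gtn_eqF m_gt0) !mul0n muln0 mul1n !addn0 add0n => dE.
  by rewrite -dE in d_gt0.
- split; first exact: unitary_cayley_connected MP unitE.
  exact: unitary_cayley_sum_connected MP unitE.
- split; first exact: unitary_cayley_not_bipartite.
  exact: has_loop_not_bipartite.
Qed.
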